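(* Let $k\geq 1$ and let $X$ be an extremal undirected circulant graph of degree $4$ and diameter $k$ (up to isomorphism, $X=X(\mathbb{Z}_n,\{\pm 1,\pm(2k+1)\})$ with $n=2k^2+2k+1$). Then the odd girth of $X$ is $2k+1$.
   Context: An undirected circulant graph $X(\mathbb{Z}_n,C)$ has vertex set $\mathbb{Z}_n$, with $i,j$ adjacent iff $j-i\in C$, where $C\subseteq\mathbb{Z}_n\setminus\{0\}$ is inverse-closed; its degree is $|C|$. An extremal circulant graph of degree $d$ and diameter $k$ is one of maximum order among circulant graphs of degree $d$ and diameter $k$; for $d=4$ it is known (Chen–Jia) that this maximum order is $2k^2+2k+1$ and the extremal graph is unique up to isomorphism, given by the generator set $\{1,2k+1\}$. The odd girth of a graph is the length of its shortest cycle of odd length. *)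

(* Defs.v *)
From mathcomp Require Import all_boot all_order all_algebra.

Set Implicit Arguments.
Unset Strict Implicit.
Unset Printing Implicit Defensive.

Import GRing.Theory.
Local Open Scope ring_scope.

Section Graph.

Variables (T : finType) (e : rel T).

Definition has_walk (x y : T) (m : nat) : Prop :=
  exists p : seq T, [/\ path e x p, last x p = y & size p = m].

Definition is_distance (x y : T) (m : nat) : Prop :=
  has_walk x y m /\ forall m' : nat, has_walk x y m' -> (m <= m')%N.

(* A disconnected graph has no diameter in this sense. *)
Definition is_diameter (k : nat) : Prop :=
  (forall x y : T, exists2 m : nat, is_distance x y m & (m <= k)%N) /\
  (exists x y : T, is_distance x y k).

Definition has_odd_cycle (m : nat) : Prop :=
  exists c : seq T, [/\ ucycle e c, (2 < size c)%N, odd (size c) & size c = m].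

Definition is_odd_girth (g : nat) : Prop :=
  has_odd_cycle g /\ forall m : nat, has_odd_cycle m -> (g <= m)%N.

End Graph.

Definition connection_set (n : nat) (C : {set 'Z_n}) : Prop :=
  0 \notin C /\ forall c : 'Z_n, c \in C -> - c \in C.

Definition circulant (n : nat) (C : {set 'Z_n}) : rel 'Z_n :=
  fun i j => j - i \in C.

(* The condition 1 < n is there because 'Z_0 and 'Z_1 are copies of Z/2Z;
   under it #|'Z_n| = n. *)
Definition circulant_degree_diameter (d k n : nat) (C : {set 'Z_n}) : Prop :=
  [/\ (1 < n)%N, connection_set C, #|C| = d & is_diameter (circulant C) k].

Definition extremal_circulant (d k n : nat) (C : {set 'Z_n}) : Prop :=
  circulant_degree_diameter d k C /\
  forall (n' : nat) (C' : {set 'Z_n'}),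
    circulant_degree_diameter d k C' -> (n' <= n)%N.

(* Main.v *)
Require Import Defs.
From mathcomp Require Import all_boot all_order all_algebra.
From mathcomp Require Import zify.

(** Inverse-closedness forces [C = {a, -a, b, -b}], so a vertex within distance
    [k] of [0] is [x a + y b] with [|x| + |y| <= k].  The l1-ball of radius [k]
    in Z^2 has [(k+1)^2 + k^2] points, hence that many vertices at most, and
    [{1, -1, 2k+1, -(2k+1)}] attains this bound.  So for an extremal graph the
    map [(x, y) |-> x a + y b] is injective on the ball.  Every vector of norm at
    most [2k] is a difference of two points of the ball, so nonzero vectors of the
    kernel have norm at least [2k+1]; this excludes shorter odd cycles.  Conversely
    [(k+1, 0)] is congruent to some point of the ball, and their difference is a
    kernel vector of norm exactly [2k+1]; a monotone lattice path along it
    projects to a simple cycle. *)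

Set Implicit Arguments.
Unset Strict Implicit.
Unset Printing Implicit Defensive.

Import Order.TTheory GRing.Theory Num.Theory.
Local Open Scope ring_scope.
Local Arguments absz m%_R.

(** * The l1-ball and monotone paths in Z^2 *)

Definition ball_index (k : nat) : finType :=
  (('I_k.+1 * 'I_k.+1) + ('I_k * 'I_k))%type.

(* In the coordinates x + y and x - y the ball splits, by parity, into a square
   grid of side k + 1 and one of side k. *)
Definition ball_point (k : nat) (t : ball_index k) : int * int :=
  match t with
  | inl (i, j) => (i%:Z + j%:Z - k%:Z, i%:Z - j%:Z)
  | inr (i, j) => (i%:Z + j%:Z - k%:Z + 1, i%:Z - j%:Z)
  end.

Lemma card_ball_index k : #|ball_index k| = (2 * k ^ 2 + 2 * k + 1)%N.
Proof. rewrite card_sum !card_prod !card_ord; nia. Qed.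

Lemma ball_pointP k (x y : int) : (absz x + absz y <= k)%N ->
  exists t : ball_index k, ball_point t = (x, y).
Proof.
move=> h; case: (boolP (odd (absz (x + y + k%:Z)))) => par.
- have hi : (absz (x + y + k%:Z - 1) %/ 2 < k)%N by lia.
  have hj : (absz (x - y + k%:Z - 1) %/ 2 < k)%N by lia.
  by exists (inr (Ordinal hi, Ordinal hj)); congr pair => /=; lia.
- have hi : (absz (x + y + k%:Z) %/ 2 < k.+1)%N by lia.
  have hj : (absz (x - y + k%:Z) %/ 2 < k.+1)%N by lia.
  by exists (inl (Ordinal hi, Ordinal hj)); congr pair => /=; lia.
Qed.

(** Walk from the origin to [(x, y)], first along the first axis, and stop after at most [k] steps:
    at most [k] steps remain. *)
Lemma split_vector k (x y : int) : (absz x + absz y <= 2 * k)%N ->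
  exists u v : int, (absz u + absz v <= k)%N
    /\ (absz (x - u) + absz (y - v) <= k)%N.
Proof.
move=> h; case: (leqP (absz x) k) => hx.
- case: (leqP (absz x + absz y) k) => hxy.
    by exists x, y; lia.
  case: (lerP 0 y) => hy.
  + by exists x, (k%:Z - (absz x)%:Z); lia.
  + by exists x, (- (k%:Z - (absz x)%:Z)); lia.
- case: (lerP 0 x) => hx0.
  + by exists k%:Z, 0; lia.
  + by exists (- k%:Z), 0; lia.
Qed.

(** Position after [i] steps, first axis first. The truncated subtraction [i - absz x] keeps the
    second coordinate at 0 during the first leg. *)
Definition lattice_path (x y : int) (i : nat) : int * int :=
  ((if 0 <= x then (minn i (absz x))%:Z else - (minn i (absz x))%:Z),
   (if 0 <= y then (minn (i - absz x) (absz y))%:Z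
    else - (minn (i - absz x) (absz y))%:Z)).

Lemma lattice_path0 x y : lattice_path x y 0 = (0, 0).
Proof. by rewrite /lattice_path; congr pair; case: ifP => _; lia. Qed.

Lemma lattice_path_end x y : lattice_path x y (absz x + absz y) = (x, y).
Proof. by rewrite /lattice_path; congr pair; case: ifP => h; lia. Qed.

Lemma lattice_path_dist x y i j : (i <= j <= absz x + absz y)%N ->
  (absz ((lattice_path x y j).1 - (lattice_path x y i).1)
   + absz ((lattice_path x y j).2 - (lattice_path x y i).2) = j - i)%N.
Proof. by rewrite /lattice_path /=; case: (0 <= x); case: (0 <= y); lia. Qed.

(** * Walks in arbitrary graphs *)

Lemma path_map_iota (T : Type) (e : rel T) (g : nat -> T) m s :
    (forall i, (s <= i < s + m)%N -> e (g i) (g i.+1)) ->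
  path e (g s) [seq g i | i <- iota s.+1 m].
Proof.
elim: m s => //= m IH s h; rewrite h /=; last by lia.
by apply: IH => i hi; apply: h; lia.
Qed.

Lemma has_walk_is_distance (T : finType) (e : rel T) x y m :
  has_walk e x y m -> exists2 d, is_distance e x y d & (d <= m)%N.
Proof.
(* Walks of a fixed length form a finite type, so their existence is decidable and a least length
   can be extracted. *)
pose W i := [exists p : i.-tuple T, path e x p && (last x p == y)].
have WP i : reflect (has_walk e x y i) (W i).
  apply: (iffP existsP) => [[p /andP[hp /eqP hl]]|[p [hp hl /eqP hs]]].
    by exists p; split; rewrite ?size_tuple.
  by exists (Tuple hs); rewrite /= hp hl eqxx.
move=> /WP hm; have exW : exists i, W i by exists m.
case: (ex_minnP exW) => d hd dmin; exists d; last exact: dmin.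
by split=> [|j /WP]; [apply/WP | apply: dmin].
Qed.

(** * Walks in the circulant graph as images of lattice walks *)

Section Generators.

Variables (n : nat) (a b : 'Z_n).

Definition lattice_map (u v : int) : 'Z_n := a *~ u + b *~ v.

Definition pm_set : {set 'Z_n} := [set a; - a; b; - b].

Lemma lattice_mapB u v u' v' :
  lattice_map (u - u') (v - v') = lattice_map u v - lattice_map u' v'.
Proof. by rewrite /lattice_map !mulrzBr opprD addrACA. Qed.

Lemma lattice_mapD u v u' v' :
  lattice_map (u + u') (v + v') = lattice_map u v + lattice_map u' v'.
Proof. by rewrite /lattice_map !mulrzDr addrACA. Qed.

Lemma lattice_map0 : lattice_map 0 0 = 0.
Proof. by rewrite /lattice_map !mulr0z addr0. Qed.

Lemma pm_set_unit_vector c : c \in pm_set ->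
  exists u v : int, (absz u + absz v = 1)%N /\ c = lattice_map u v.
Proof.
rewrite !inE -!orbA => /or4P[] /eqP->.
- by exists 1, 0; rewrite /lattice_map mulr1z mulr0z addr0.
- by exists (-1), 0; rewrite /lattice_map mulrN1z mulr0z addr0.
- by exists 0, 1; rewrite /lattice_map mulr1z mulr0z add0r.
- by exists 0, (-1); rewrite /lattice_map mulrN1z mulr0z add0r.
Qed.

Lemma unit_vector_pm_set u v :
  (absz u + absz v = 1)%N -> lattice_map u v \in pm_set.
Proof.
move=> h; rewrite /lattice_map !inE.
have : [\/ u = 1 /\ v = 0, u = -1 /\ v = 0, u = 0 /\ v = 1 | u = 0 /\ v = -1].
  have : (u = 1 /\ v = 0) \/ (u = -1 /\ v = 0) \/ (u = 0 /\ v = 1)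
     \/ (u = 0 /\ v = -1) by lia.
  by move=> [|[|[|]]] ?; [constructor 1|constructor 2|constructor 3|constructor 4].
by case=> -[-> ->]; rewrite ?mulr1z ?mulrN1z ?mulr0z ?addr0 ?add0r eqxx ?orbT.
Qed.

(** Each edge lifts to a unit vector, which changes the norm by at most 1 and flips the parity of
    [u + v]. *)
Lemma path_displacement (x : 'Z_n) p : path (circulant pm_set) x p ->
  exists u v : int, [/\ last x p - x = lattice_map u v,
    (absz u + absz v <= size p)%N & odd (absz (u + v)) = odd (size p)].
Proof.
elim: p x => [|y p IH] x /=.
  by move=> _; exists 0, 0; rewrite lattice_map0 subrr.
move=> /andP[/pm_set_unit_vector[u [v [huv e]]] /IH[u' [v' [e' hs hp]]]].
exists (u' + u), (v' + v); split; [|lia|lia].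
by rewrite lattice_mapD -e -e' addrA subrK.
Qed.

Lemma path_lattice_path (x : 'Z_n) u v m (g := fun i : nat =>
      x + lattice_map (lattice_path u v i).1 (lattice_path u v i).2) :
    m = (absz u + absz v)%N ->
  path (circulant pm_set) (g 0%N) [seq g i | i <- iota 1 m].
Proof.
move=> hm; apply: path_map_iota => i hi; rewrite /circulant /g.
rewrite opprD addrACA subrr add0r -lattice_mapB.
by apply: unit_vector_pm_set; rewrite lattice_path_dist; lia.
Qed.

Lemma has_walk_lattice_map (x y : 'Z_n) u v : y - x = lattice_map u v ->
  has_walk (circulant pm_set) x y (absz u + absz v).
Proof.
move=> e; have := path_lattice_path x (erefl (absz u + absz v)%N).
rewrite lattice_path0 lattice_map0 addr0 => hp.
eexists; split; [exact: hp| | by rewrite size_map size_iota].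
have [m0|m0] := posnP (absz u + absz v).
  have [u0 v0] : u = 0 /\ v = 0 by lia.
  by move: e; rewrite u0 v0 /= lattice_map0 => /subr0_eq.
rewrite -nth_last size_map size_iota (nth_map 0%N) ?size_iota ?nth_iota; try lia.
rewrite add1n prednK // lattice_path_end /= -e.
by rewrite addrC subrK.
Qed.

(** * Covering the group by the image of the ball *)

Hypothesis n_gt1 : (1 < n)%N.

Definition ball_cover (k : nat) :=
  forall z : 'Z_n, exists u v : int,
    (absz u + absz v <= k)%N /\ z = lattice_map u v.

Lemma card_Z : #|'Z_n| = n.
Proof. by rewrite card_ord Zp_cast. Qed.

Let ball_map k (t : ball_index k) :=
  lattice_map (ball_point t).1 (ball_point t).2.

Lemma ball_map_surj k : ball_cover k ->
  #|[set ball_map t | t in ball_index k]| = n.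
Proof.
move=> cov; rewrite -[RHS]card_Z -cardsT; apply: eq_card => z.
rewrite inE; apply/imsetP.
have [u [v [huv ->]]] := cov z; have [t e] := ball_pointP huv.
by exists t; rewrite // /ball_map e.
Qed.

Lemma ball_cover_order_le k : ball_cover k -> (n <= 2 * k ^ 2 + 2 * k + 1)%N.
Proof.
by move=> cov; rewrite -card_ball_index -{1}(ball_map_surj cov) leq_imset_card.
Qed.

(** A surjection between finite sets of equal size is injective. *)
Lemma ball_cover_inj k u v u' v' :
    ball_cover k -> n = (2 * k ^ 2 + 2 * k + 1)%N ->
    (absz u + absz v <= k)%N -> (absz u' + absz v' <= k)%N ->
  lattice_map u v = lattice_map u' v' -> u = u' /\ v = v'.
Proof.
move=> cov en h h' e.
have inj : {in ball_index k &, injective (@ball_map k)}.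
  by apply/imset_injP; rewrite ball_map_surj // card_ball_index -en.
have [t et] := ball_pointP h; have [t' et'] := ball_pointP h'.
have ett : t = t' by apply: inj; rewrite // /ball_map et et'.
by move: et'; rewrite -ett et => -[].
Qed.

Lemma kernel_norm k u v :
    ball_cover k -> n = (2 * k ^ 2 + 2 * k + 1)%N ->
    lattice_map u v = 0 -> (absz u + absz v <= 2 * k)%N ->
  u = 0 /\ v = 0.
Proof.
move=> cov en e0 /split_vector[x [y [h1 h2]]].
have h3 : (absz (x - u) + absz (y - v) <= k)%N by lia.
have [|] := ball_cover_inj cov en h1 h3; last by lia.
by rewrite lattice_mapB e0 subr0.
Qed.

Lemma diameter_ball_cover k : is_diameter (circulant pm_set) k -> ball_cover k.
Proof.
move=> [h _] z; have [m [[p [hp hl hs]] _] hm] := h 0 z.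
have [u [v [e hn _]]] := path_displacement hp.
by exists u, v; rewrite -e hl subr0; split=> //; rewrite (leq_trans hn) ?hs.
Qed.

(** * Odd girth when the order meets the ball bound *)

Lemma perfect_odd_girth k :
    (0 < k)%N -> ball_cover k -> n = (2 * k ^ 2 + 2 * k + 1)%N ->
  is_odd_girth (circulant pm_set) (2 * k + 1).
Proof.
move=> k0 cov en; split; last first.
  move=> m [[|x p] [/andP[hc _] hs2 hodd hm]]; first by [].
  rewrite leqNgt; apply/negP => hlt.
  have [u [v [e hn par]]] := path_displacement hc.
  rewrite last_rcons subrr size_rcons in e hn par.
  (* The displacement of a short closed walk is a short kernel vector, hence zero; its parity is
     then even, against the odd length. *)
  have [] := @kernel_norm k u v cov en (esym e); first by move: hm => /=; lia.
  by move=> u0 v0; move: par hodd; rewrite u0 v0 /= => <-.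
have [x [y [hxy e]]] := cov (lattice_map (k%:Z + 1) 0).
pose u := k%:Z + 1 - x; pose v := 0 - y.
have e0 : lattice_map u v = 0 by rewrite lattice_mapB e subrr.
have norm_uv : (absz u + absz v = 2 * k + 1)%N.
  (* The norm is at most [(k + 1) + k]. If it were at most [2 * k], the vector would vanish and
     [(k + 1, 0)] would lie in the ball. *)
  have [hle|] := leqP (absz u + absz v) (2 * k); last by lia.
  have [] := kernel_norm cov en e0 hle; lia.
pose g i := 0 + lattice_map (lattice_path u v i).1 (lattice_path u v i).2.
have := path_lattice_path 0 (erefl (absz u + absz v)%N).
rewrite norm_uv -/g => hp.
have g_end : g (2 * k + 1)%N = g 0%N.
  by rewrite /g -norm_uv lattice_path_end lattice_path0 lattice_map0 /= e0.
exists [seq g i | i <- iota 0 (2 * k + 1)].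
rewrite size_map size_iota; split; [|lia|lia|by []].
apply/andP; split.
  have -> : iota 0 (2 * k + 1) = 0%N :: iota 1 (2 * k) by rewrite addn1.
  by move: hp; rewrite iotaD map_cat /= cats1 add1n -[(2 * k).+1]addn1 g_end.
rewrite map_inj_in_uniq ?iota_uniq //.
(* A repeated vertex would make the difference of two path points a kernel vector of norm [j - i],
   with [0 < j - i <= 2 * k]. *)
have main i j : (i < j < 2 * k + 1)%N -> g i <> g j.
  move=> hij eg.
  have hd := @lattice_path_dist u v i j.
  have [||] := @kernel_norm k
    ((lattice_path u v j).1 - (lattice_path u v i).1)
    ((lattice_path u v j).2 - (lattice_path u v i).2) cov en.
  - by move: eg; rewrite /g !add0r lattice_mapB => ->; rewrite subrr.
  - by rewrite hd; lia.
  - by move=> h1 h2; move: hd; rewrite h1 h2 /=; lia.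
move=> i j; rewrite !mem_iota => hi hj eg.
have [hij|hij|//] := ltngtP i j.
- by case: (@main i j) => //; lia.
- by case: (@main j i) => //; lia.
Qed.

End Generators.

(** * Shape of a connection set with four elements *)

Lemma Zp_involution n (c : 'Z_n) : (1 < n)%N -> c != 0 -> - c = c ->
  n = (2 * c)%N.
Proof.
move=> n1 c0 /eqP; rewrite eq_sym -addr_eq0 => /eqP/(congr1 val) /=.
rewrite [in X in (_ %% X)%N]Zp_cast // => e.
have c_lt : (c < n)%N by rewrite -[X in (_ < X)%N](Zp_cast n1).
have c_gt : (0 < c)%N.
  by rewrite lt0n; apply: contraNneq c0 => c0; apply/eqP/val_inj.
have /dvdnP[[|[|q]] eq] : (n %| c + c)%N by rewrite /dvdn e.
all: nia.
Qed.

(** The only possible nonzero self-inverse element is [n / 2], so two distinct elements cannot both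
    be self-inverse. *)
Lemma exists_noninvolution n (D : {set 'Z_n}) : (1 < n)%N -> 0 \notin D ->
  (1 < #|D|)%N -> exists2 c, c \in D & - c != c.
Proof.
move=> n1 D0 /card_gt1P[x [y [xD yD xy]]].
have nz z : z \in D -> z != 0 by apply: contraTneq => ->.
have [ex|] := eqVneq (- x) x; last by exists x.
have [ey|] := eqVneq (- y) y; last by exists y.
have := Zp_involution n1 (nz _ xD) ex; have := Zp_involution n1 (nz _ yD) ey.
by move=> e1 e2; case/eqP: xy; apply: val_inj => /=; lia.
Qed.

Lemma connection_set4 n (C : {set 'Z_n}) : (1 < n)%N -> connection_set C ->
  #|C| = 4%N -> exists a b, C = pm_set a b.
Proof.
move=> n1 [C0 CN] C4.
have [a aC na] : exists2 c, c \in C & - c != c.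
  by apply: exists_noninvolution; rewrite ?C4.
pose D := C :\: [set a; - a].
have aaC : [set a; - a] \subset C by rewrite subUset !sub1set aC CN.
have D2 : #|D| = 2%N.
  by rewrite cardsD (setIidPr aaC) C4 cards2 eq_sym na.
have [b bD nb] : exists2 c, c \in D & - c != c.
  by apply: exists_noninvolution; rewrite ?D2 // !inE negb_and C0 orbT.
exists a, b; move: (bD); rewrite !inE negb_or => /andP[/andP[ba bNa] bC].
have NbD : - b \in D.
  by rewrite !inE negb_or CN // andbT eqr_opp eqr_oppLR bNa ba.
have bbD : [set b; - b] = D.
  by apply/eqP; rewrite eqEcard subUset !sub1set bD NbD D2 cards2 eq_sym nb.
by rewrite /pm_set -setUA bbD /D setDE setUIr setUCr setIT (setUidPr aaC).
Qed.

(** * The graph with generators 1 and 2k+1 attains the bound *)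

Section ExtremalExample.

Variables (k : nat).
Hypothesis k_gt0 : (0 < k)%N.

Let n := (2 * k ^ 2 + 2 * k + 1)%N.
Let n_gt1 : (1 < n)%N. Proof. by rewrite /n; nia. Qed.
Let a : 'Z_n := 1.
Let b : 'Z_n := (2 * k + 1)%:R.

Let lattice_mapE u v (N : nat) (t : int) :
  u + v * (2 * k + 1)%N%:Z + t * n%:Z = N%:Z -> N%:R = lattice_map a b u v.
Proof.
move=> h; rewrite -[LHS]/(N%:Z%:~R) -h !rmorphD !rmorphM /= -!pmulrn.
rewrite pchar_Zp // mulr0 addr0 /lattice_map /a /b.
by rewrite -[(2 * k + 1)%:R *~ v]mulrzr [X in _ + X]mulrC.
Qed.

Lemma example_ball_cover : ball_cover a b k.
Proof.
move=> z.
have z_lt : (z < n)%N by rewrite -[X in (_ < X)%N](Zp_cast n_gt1).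
rewrite -(natr_Zp z).
pose q := ((z + k) %/ (2 * k + 1))%N; pose s := ((z + k) %% (2 * k + 1))%N.
have zE : (z + k = q * (2 * k + 1) + s)%N by rewrite -divn_eq.
have s_lt : (s < 2 * k + 1)%N by rewrite ltn_mod addn1.
move: (nat_of_ord z) q s zE s_lt z_lt => N q s zE s_lt; rewrite /n => z_lt.
have q_le : (q <= k)%N.
  (* Tight: [(2 * k + 1) * (k + 1) = n + k], while [N + k < n + k]. *)
  rewrite leqNgt; apply/negP => /(leq_mul (leqnn (2 * k + 1))) hq; nia.
(* Balanced division: [N = r + q * (2 * k + 1)] with [r] between [-k] and [k]. If [(r, q)] leaves
   the ball, subtracting [(k + 1, k)] or [(-k, k + 1)], both of which map to [n], brings it back. *)
pose r := s%:Z - k%:Z.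
have [hle|hgt] := leqP (absz r + q) k.
  exists r, q%:Z; split; first by lia.
  by apply: (@lattice_mapE _ _ _ 0); rewrite /r; nia.
have [r0|r0] := lerP 0 r.
  exists (r - k%:Z - 1), (q%:Z - k%:Z); split; first by lia.
  by apply: (@lattice_mapE _ _ _ 1); rewrite /r /n; nia.
exists (r + k%:Z), (q%:Z - k%:Z - 1); split; first by lia.
by apply: (@lattice_mapE _ _ _ 1); rewrite /r /n; nia.
Qed.

Lemma example_degree_diameter : circulant_degree_diameter 4 k (pm_set a b).
Proof.
have ker u v := @kernel_norm n a b n_gt1 k u v example_ball_cover erefl.
(* Coincidences among [0], [a], [-a], [b], [-b] would be kernel vectors of norm 1 or 2, and
   [2 <= 2 * k]. *)
have nz u v : (0 < absz u + absz v <= 2 * k)%N -> lattice_map a b u v != 0.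
  by move=> h; apply/eqP => /ker; lia.
have aE : a = lattice_map a b 1 0 by rewrite /lattice_map mulr1z mulr0z addr0.
have bE : b = lattice_map a b 0 1 by rewrite /lattice_map mulr1z mulr0z add0r.
have a0 : a != 0 by rewrite aE nz //; lia.
have b0 : b != 0 by rewrite bE nz //; lia.
have aa : a != - a.
  by rewrite -addr_eq0 {1 2}aE -lattice_mapD nz //; lia.
have bb : b != - b.
  by rewrite -addr_eq0 {1 2}bE -lattice_mapD nz //; lia.
have ab : a != b.
  rewrite -subr_eq0; have -> : a - b = lattice_map a b (1 - 0) (0 - 1).
    by rewrite lattice_mapB -aE -bE.
  by rewrite nz //; lia.
have aNb : a != - b.
  rewrite -addr_eq0; have -> : a + b = lattice_map a b (1 + 0) (0 + 1).
    by rewrite lattice_mapD -aE -bE.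
  by rewrite nz //; lia.
split=> //.
- split; first by rewrite !inE !negb_or ![0 == _]eq_sym !oppr_eq0 a0 b0.
  move=> c; rewrite !inE -!orbA => /or4P[] /eqP->;
    by rewrite ?opprK eqxx ?orbT.
- rewrite /pm_set -!setUA !cardsU1 cards1 !inE !negb_or.
  by rewrite aa ab aNb bb eqr_oppLR aNb eqr_opp ab.
split.
- move=> x y; have [u [v [huv e]]] := example_ball_cover (y - x).
  have [d hd hle] := has_walk_is_distance (has_walk_lattice_map e).
  by exists d => //; apply: leq_trans huv.
(* A walk shorter than [k] to this vertex would give it a second preimage in the ball, besides
   [(k, 0)]. *)
exists 0, (lattice_map a b k%:Z 0); split.
  have := @has_walk_lattice_map n a b 0 _ k%:Z 0 (subr0 _).
  by rewrite addn0.
move=> m [p [hp hl hs]]; rewrite leqNgt; apply/negP => m_lt.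
have [u [v [e hn _]]] := path_displacement hp.
rewrite hl subr0 in e; rewrite hs in hn.
have [||] := ball_cover_inj n_gt1 example_ball_cover erefl _ _ e; lia.
Qed.

End ExtremalExample.

Theorem theorem8 (k : nat) (hk : (1 <= k)%N) (n : nat) (C : {set 'Z_n})
    (hX : extremal_circulant 4 k C) :
  is_odd_girth (circulant C) (2 * k + 1)%N.
Proof.
case: hX => -[n1 conn C4 diam] ext.
have [a [b eC]] := connection_set4 n1 conn C4; rewrite eC in diam *.
have cov := diameter_ball_cover diam.
(* The covering bounds [n] from above; maximality against the example bounds it from below. *)
apply: perfect_odd_girth => //; apply/eqP; rewrite eqn_leq.
by rewrite (ball_cover_order_le n1 cov) (ext _ _ (example_degree_diameter hk)).
Qed.
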